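(* Let $(V,\partial,\mathcal I)$ be a non-unital vertex algebra over $\mathbb F$, let $w\in\mathbb F$, and let $P:V\to V$ be a Rota--Baxter operator of weight $w$ (in particular $P\partial=\partial P$). Define a new integrated bracket $\mathcal I^{\star_R}:V\otimes V\to V[\mu]$ by $$\mathcal I^{\star_R}_{a,b}(\mu):=\mathcal I_{a,Pb}(\mu)+\mathcal I_{Pa,b}(\mu)+w\,\mathcal I_{a,b}(\mu)\qquad\text{for all }a,b\in V.$$ Then $(V,\partial,\mathcal I^{\star_R})$ is a non-unital vertex algebra. Moreover, $P$ is a homomorphism of non-unital vertex algebras from $(V,\partial,\mathcal I^{\star_R})$ to $(V,\partial,\mathcal I)$, that is, $$\mathcal I_{Pa,Pb}(\mu)=P\bigl(\mathcal I^{\star_R}_{a,b}(\mu)\bigr)\qquad\text{for all }a,b\in V.$$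
   Context: $\mathbb F$ is a field of characteristic $0$. A non-unital vertex algebra over $\mathbb F$ is a triple $(V,\partial,\mathcal I)$ where $V$ is a vector superspace over $\mathbb F$ (with parity $\varepsilon(a)\in\{0,1\}$ of a homogeneous $a\in V$), $\partial:V\to V$ is an endomorphism (the translation operator), and $\mathcal I:V\otimes V\to V[\lambda]$, $a\otimes b\mapsto \mathcal I_{a,b}(\lambda)$, is a linear map (the integrated $\lambda$-bracket, $\lambda$ a formal variable), such that for all $a,b,c\in V$ (homogeneous where parities occur): (V2) $\frac{d}{d\lambda}\mathcal I_{\partial a,b}(\lambda)=-\lambda\frac{d}{d\lambda}\mathcal I_{a,b}(\lambda)$ and $\partial\,\mathcal I_{a,b}(\lambda)=\mathcal I_{\partial a,b}(\lambda)+\mathcal I_{a,\partial b}(\lambda)$; (V3) $\mathcal I_{b,a}(\lambda)=(-1)^{\varepsilon(a)\varepsilon(b)}\,\mathcal I_{a,b}(-\lambda-\partial)$; (V4) $\mathcal I_{a,\mathcal I_{b,c}(\mu)}(\lambda)-(-1)^{\varepsilon(a)\varepsilon(b)}\,\mathcal I_{b,\mathcal I_{a,c}(\lambda)}(\mu)=\mathcal I_{\mathcal I_{a,b}(\lambda)-\mathcal I_{a,b}(-\mu-\partial),\,c}(\lambda+\mu)$, an identity in $V[\lambda,\mu]$. Conventions: if $\mathcal I_{a,b}(\lambda)=\sum_n v_n\lambda^n$, then $\mathcal I_{a,b}(-\lambda-\partial)=\sum_n(-\lambda-\partial)^n v_n$, with $\partial$ acting on the coefficients $v_n$; $\partial$,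 and $\mathcal I$ in each of its arguments, are extended to polynomials in formal variables with coefficients in $V$ by linearity over the polynomial ring. A Rota--Baxter operator of weight $w\in\mathbb F$ on $(V,\partial,\mathcal I)$ is a linear map $P:V\to V$ with $P\partial=\partial P$ such that, extending $P$ coefficientwise to $V[\mu]$ by $P(\sum v_n\mu^n)=\sum P(v_n)\mu^n$, one has for all $a,b\in V$ $$\mathcal I_{Pa,Pb}(\mu)=P\bigl(\mathcal I_{Pa,b}(\mu)+\mathcal I_{a,Pb}(\mu)+w\,\mathcal I_{a,b}(\mu)\bigr).$$ A homomorphism of non-unital vertex algebras is a linear map commuting with the translation operators and carrying one integrated bracket to the other, as displayed in the claim.
   Formalization: The translation operator, the integrated bracket and the Rota–Baxter operator P are taken to preserve parity (and the new bracket and homomorphism are shown to), the usual superspace convention; for a P that does not preserve parity the claim can fail (V3). *)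

(* Defs.v *)
From HB Require Import structures.
From mathcomp Require Import all_boot all_order all_algebra.
From mathcomp Require Import finmap monalg.

Set Implicit Arguments.
Unset Strict Implicit.
Unset Printing Implicit Defensive.

Import GRing.Theory.
Local Open Scope ring_scope.

(* All linear maps between superspaces (translation operators, brackets,
   Rota-Baxter operators, homomorphisms) are required to preserve parity, the
   formal variables being even. *)
Record superspace (F : fieldType) := Superspace {
  supersort :> lmodType F;
  (* homog false and homog true are the even and odd parts *)
  homog : bool -> {pred supersort};
  homog_closed : forall e, submod_closed (homog e);
  homog_span : forall a, exists a0 a1,
    [/\ a0 \in homog false, a1 \in homog true & a = a0 + a1];
  homog_direct : forall a, a \in homog false -> a \in homog true -> a = 0 }.

Arguments homog {F} s e : rename.

(* (-1)^(ε(a) ε(b)), for a and b of parities e and f *)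
Definition koszul (F : fieldType) (e f : bool) : F := (-1) ^+ (e && f).

Definition even_map (F : fieldType) (U V : superspace F) (f : U -> V) : Prop :=
  forall (e : bool) (a : U), a \in homog U e -> f a \in homog V e.

(* U[λ], the formal polynomials with coefficients in a module U; the
   coefficient of λ^n in p is p@_n, and << u *g n >> is u λ^n.  Since U[λ] is
   again a module, U[λ,μ] is obtained by iteration. *)
Definition modpoly (R : pzRingType) (U : lmodType R) : Type := {malg U[nat]}.

Section ModPolyLmod.
Variables (R : pzRingType) (U : lmodType R).

HB.instance Definition _ := GRing.Zmodule.on (modpoly U).

Implicit Type p : modpoly U.

Definition mp_scale (c : R) p : modpoly U :=
  [malg n in msupp p => c *: p@_n].

Lemma mp_scaleE c p n : (mp_scale c p)@_n = c *: p@_n.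
Proof. by rewrite mcoeffE; case: msuppP; rewrite ?scaler0. Qed.

Lemma mp_scaleA a b p : mp_scale a (mp_scale b p) = mp_scale (a * b) p.
Proof. by apply/malgP => n; rewrite !mp_scaleE scalerA. Qed.

Lemma mp_scale1 : left_id 1 mp_scale.
Proof. by move=> p; apply/malgP => n; rewrite mp_scaleE scale1r. Qed.

Lemma mp_scaleDr : right_distributive mp_scale +%R.
Proof.
move=> c p q; apply/malgP => n.
by rewrite mp_scaleE !mcoeffD !mp_scaleE scalerDr.
Qed.

Lemma mp_scaleDl p : {morph mp_scale^~ p : a b / a + b}.
Proof.
by move=> a b; apply/malgP => n; rewrite mcoeffD !mp_scaleE scalerDl.
Qed.

HB.instance Definition _ := GRing.Zmodule_isLmodule.Build R (modpoly U)
  mp_scaleA mp_scale1 mp_scaleDr mp_scaleDl.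

End ModPolyLmod.

Section ModPolyOps.
Variables (R : pzRingType) (U W : lmodType R).

Definition mp_map (f : U -> W) (p : modpoly U) : modpoly W :=
  [malg n in msupp p => f p@_n].

(* multiplication by the formal variable *)
Definition mp_mulX (p : modpoly U) : modpoly U :=
  \sum_(n <- msupp p) << p@_n *g n.+1 >>.

Definition mp_deriv (p : modpoly U) : modpoly U :=
  \sum_(n <- msupp p) << p@_n *+ n *g n.-1 >>.

(* For p = \sum_n u_n λ^n, the value \sum_n x^n (phi u_n), where x is an
   operator on W: the variable λ is replaced by x and the coefficients are
   sent to W by phi. *)
Definition mp_subst (phi : U -> W) (x : W -> W) (p : modpoly U) : W :=
  \sum_(n <- msupp p) iter n x (phi p@_n).

End ModPolyOps.

(* p(-λ-∂) in V[λ] *)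
Definition mp_skew (R : pzRingType) (V : lmodType R) (d : V -> V)
    (p : modpoly V) : modpoly V :=
  mp_subst (fun v => << v *g 0%N >> : modpoly V)
           (fun q => - mp_mulX q - mp_map d q) p.

Section TwoVariables.
Variables (R : pzRingType) (V : lmodType R).

(* V[λ,μ] as V[λ][μ]: the inner variable is λ, the outer one is μ *)
Definition bipoly : lmodType R := modpoly (modpoly V).

Definition mul_lambda : bipoly -> bipoly := mp_map (@mp_mulX R V).
Definition mul_mu : bipoly -> bipoly := @mp_mulX R (modpoly V).
Definition bi_map (d : V -> V) : bipoly -> bipoly := mp_map (mp_map d).

(* p(x), for p in V[λ] and x an operator on V[λ,μ] *)
Definition bi_at (x : bipoly -> bipoly) (p : modpoly V) : bipoly :=
  mp_subst (fun v => << (<< v *g 0%N >> : modpoly V) *g 0%N >> : bipoly) x p.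

Definition at_lambda : modpoly V -> bipoly := bi_at mul_lambda.
Definition at_mu : modpoly V -> bipoly := bi_at mul_mu.
Definition at_lambda_plus_mu : modpoly V -> bipoly :=
  bi_at (fun q => mul_lambda q + mul_mu q).
Definition at_skew_mu (d : V -> V) : modpoly V -> bipoly :=
  bi_at (fun q => - mul_mu q - bi_map d q).

(* the extension of phi : V -> V[λ,μ] to V[λ,μ] by linearity over the
   polynomial ring in λ and μ *)
Definition bi_ext (phi : V -> bipoly) : bipoly -> bipoly :=
  mp_subst (mp_subst phi mul_lambda) mul_mu.

End TwoVariables.

Record nonunital_vertex_algebra (F : fieldType) (V : superspace F)
    (d : {linear V -> V}) (I : V -> V -> modpoly V) : Prop := {
  nva_d_even : even_map d;
  nva_linearl : forall b, linear (I^~ b);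
  nva_linearr : forall a, linear (I a);
  nva_I_even : forall (e f : bool) (a b : V),
    a \in homog V e -> b \in homog V f ->
    forall n : nat, (I a b)@_n \in homog V (e (+) f);
  nva_sesqui : forall a b,
    mp_deriv (I (d a) b) = - mp_mulX (mp_deriv (I a b));
  nva_derivation : forall a b,
    mp_map d (I a b) = I (d a) b + I a (d b);
  nva_skewsym : forall (e f : bool) (a b : V),
    a \in homog V e -> b \in homog V f ->
    I b a = koszul F e f *: mp_skew d (I a b);
  nva_jacobi : forall (e f : bool) (a b c : V),
    a \in homog V e -> b \in homog V f ->
    bi_ext (fun v => at_lambda (I a v)) (at_mu (I b c))
      - koszul F e f *: bi_ext (fun v => at_mu (I b v)) (at_lambda (I a c))
    = bi_ext (fun v => at_lambda_plus_mu (I v c))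
             (at_lambda (I a b) - at_skew_mu d (I a b)) }.

Definition nva_hom (F : fieldType) (U V : superspace F)
    (dU : {linear U -> U}) (IU : U -> U -> modpoly U)
    (dV : {linear V -> V}) (IV : V -> V -> modpoly V)
    (f : {linear U -> V}) : Prop :=
  [/\ even_map f,
      forall a, f (dU a) = dV (f a)
    & forall a b, IV (f a) (f b) = mp_map f (IU a b)].

Definition rota_baxter (F : fieldType) (V : superspace F)
    (d : {linear V -> V}) (I : V -> V -> modpoly V) (w : F)
    (P : {linear V -> V}) : Prop :=
  [/\ even_map P,
      forall a, P (d a) = d (P a)
    & forall a b,
        I (P a) (P b) = mp_map P (I (P a) b + I a (P b) + w *: I a b)].

Definition rb_bracket (F : fieldType) (V : superspace F)
    (I : V -> V -> modpoly V) (w : F) (P : V -> V) (a b : V) : modpoly V :=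
  I a (P b) + I (P a) b + w *: I a b.

(* Main.v *)
Require Import Defs.
From HB Require Import structures.
From mathcomp Require Import all_boot all_order all_algebra.
From mathcomp Require Import finmap monalg.

(** Each axiom for the new bracket is a sum of instances of the same axiom for
    [I].  Only the Jacobi identity needs the Rota-Baxter relation: since
    [P (I*_(b,c)) = I_(Pb,Pc)], both of its sides expand, and the new identity
    is the combination of the old one at (Pa,Pb,c), (Pa,b,Pc), (a,Pb,Pc), at
    (Pa,b,c), (a,Pb,c), (a,b,Pc) with weight [w], and at (a,b,c) with weight
    [w^2]; on the right-hand side [P] passes through the substitution of
    [-mu - d] because [P] commutes with [d]. *)

Set Implicit Arguments.
Unset Strict Implicit.
Unset Printing Implicit Defensive.

Import GRing.Theory.
Local Open Scope ring_scope.

(** * Linear maps given by an unbundled linearity predicate *)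

Section LinearProp.
Variables (R : pzRingType) (U W : lmodType R) (f : U -> W).
Hypothesis lin_f : linear f.

(** Brackets and substitutions are plain functions with a proof of linearity; packing [f] makes the
    theory of bundled linear maps available for them. *)
Let lf : {linear U -> W} := HB.pack f (GRing.isLinear.Build R U W *:%R f lin_f).

Lemma lin0 : f 0 = 0. Proof. exact: (linear0 lf). Qed.
Lemma linD u v : f (u + v) = f u + f v. Proof. exact: (linearD lf). Qed.
Lemma linN u : f (- u) = - f u. Proof. exact: (linearN lf). Qed.
Lemma linB u v : f (u - v) = f u - f v. Proof. exact: (linearB lf). Qed.
Lemma linZ c u : f (c *: u) = c *: f u. Proof. exact: (linearZZ lf). Qed.
(** The argument has the shape of [rb_bracket], so any linear operation passes through the new
    bracket in one rewrite. *)
Lemma lin_comb3 c u v z : f (u + v + c *: z) = f u + f v + c *: f z.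
Proof. by rewrite !linD linZ. Qed.
Lemma lin_sum J (r : seq J) (F : J -> U) :
  f (\sum_(i <- r) F i) = \sum_(i <- r) f (F i).
Proof. exact: (linear_sum lf). Qed.

End LinearProp.

Section LinearClosure.
Variables (R : pzRingType) (U V W : lmodType R).

Lemma lin_comp (f : V -> W) (g : U -> V) :
  linear f -> linear g -> linear (fun u => f (g u)).
Proof. by move=> lf lg c u v; rewrite lg lf. Qed.

Lemma lin_add (f g : U -> V) :
  linear f -> linear g -> linear (fun u => f u + g u).
Proof. by move=> lf lg c u v; rewrite lf lg scalerDr addrACA. Qed.

Lemma lin_opp (f : U -> V) : linear f -> linear (fun u => - f u).
Proof. by move=> lf c u v; rewrite lf opprD scalerN. Qed.

Lemma lin_iter (x : U -> U) n : linear x -> linear (iter n x).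
Proof. by move=> lx; elim: n => [|n IHn] c u v //=; rewrite IHn lx. Qed.

End LinearClosure.

(** Stated over a field, because moving [c] past the scalar [k] uses commutativity. *)
Lemma lin_scale (F : fieldType) (U V : lmodType F) (c : F) (f : U -> V) :
  linear f -> linear (fun u => c *: f u).
Proof.
by move=> lf k u v; rewrite lf scalerDr !scalerA mulrC.
Qed.

(** * Sums over the support of a polynomial *)

Section ModPolySums.
Variables (R : pzRingType) (U W : lmodType R).
Implicit Types (p : modpoly U) (G : nat -> U -> W).

Lemma mp_coefZ (c : R) p n : (c *: p)@_n = c *: p@_n.
Proof. exact: mp_scaleE. Qed.

(** The added indices carry the coefficient 0, which [G n] kills. Sums over different supports can
    thus be compared on one index set. *)
Lemma sum_msupp_widen G p (D : {fset nat}) :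
  (forall n, G n 0 = 0) -> (msupp p `<=` D)%fset ->
  \sum_(n <- msupp p) G n p@_n = \sum_(n <- D) G n p@_n.
Proof.
move=> G0 sub; apply: big_fset_incl => // n _ /mcoeff_outdom ->; exact: G0.
Qed.

Lemma lin_sum_msupp G : (forall n, linear (G n)) ->
  linear (fun p => \sum_(n <- msupp p) G n p@_n).
Proof.
move=> lG c p q.
have G0 n : G n 0 = 0 by exact: lin0 (lG n).
(* [D] covers all three supports, so none of them needs to be computed from the others. *)
pose D := (msupp (c *: p + q)%R `|` (msupp p `|` msupp q))%fset.
rewrite !(@sum_msupp_widen _ _ D) //; first last.
- exact: fsubsetUl.
- by rewrite /D fsetUA fsetUAC fsubsetUr.
- by rewrite /D fsetUA fsubsetUr.
rewrite scaler_sumr -big_split /=; apply: eq_bigr => n _.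
by rewrite mcoeffD mp_coefZ lG.
Qed.

Lemma lin_monom n : linear (fun v : U => << v *g n >> : modpoly U).
Proof.
move=> c u v; apply/malgP => k; rewrite mcoeffD mp_coefZ !mcoeffU.
by rewrite mulrnDl scalerMnr.
Qed.

End ModPolySums.

(** * Coefficientwise maps, multiplication by the variable, derivative *)

Section ModPolyOpsTheory.
Variables (R : pzRingType) (U W : lmodType R).

Lemma mp_map_coef (f : U -> W) p n : f 0 = 0 -> (mp_map f p)@_n = f p@_n.
Proof. by move=> f0; rewrite /mp_map mcoeffE; case: msuppP. Qed.

Lemma msupp_mp_map (f : U -> W) p :
  f 0 = 0 -> (msupp (mp_map f p) `<=` msupp p)%fset.
Proof.
move=> f0; apply/fsubsetP => n; rewrite -!mcoeff_neq0 mp_map_coef //.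
by apply: contraNneq => ->; rewrite f0.
Qed.

Lemma lin_mp_map (f : U -> W) : linear f -> linear (mp_map f).
Proof.
move=> lf c p q; apply/malgP => n.
by rewrite mcoeffD mp_coefZ !mp_map_coef ?(lin0 lf) // mcoeffD mp_coefZ lf.
Qed.

Lemma mp_map_monom (f : U -> W) v n : f 0 = 0 ->
  mp_map f (<< v *g n >> : modpoly U) = << f v *g n >>.
Proof.
move=> f0; apply/malgP => k; rewrite mp_map_coef // !mcoeffU.
by case: eqP; rewrite ?mulr1n ?mulr0n.
Qed.

Lemma lin_mp_mulX : linear (@mp_mulX R U).
Proof.
apply: (@lin_sum_msupp R U (modpoly U) (fun n v => << v *g n.+1 >>)) => n.
exact: lin_monom.
Qed.

Lemma lin_mp_deriv : linear (@mp_deriv R U).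
Proof.
apply: (@lin_sum_msupp R U (modpoly U) (fun n v => << v *+ n *g n.-1 >>)) => n.
apply: (lin_comp (lin_monom n.-1)) => c u v.
by rewrite mulrnDl scalerMnr.
Qed.

Lemma mp_map_mulX (f : U -> W) p : linear f ->
  mp_map f (mp_mulX p) = mp_mulX (mp_map f p).
Proof.
move=> lf; have f0 := lin0 lf.
rewrite /mp_mulX (lin_sum (lin_mp_map lf)).
(* [f] may kill coefficients and shrink the support, so the right-hand sum is widened to the support
   of [p]. *)
rewrite [RHS](sum_msupp_widen (D := msupp p)
  (G := fun n v => << v *g n.+1 >> : modpoly W)) ?msupp_mp_map //; last first.
  by move=> n; exact: (lin0 (@lin_monom R W n.+1)).
by apply: eq_bigr => n _; rewrite mp_map_monom // mp_map_coef.
Qed.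

End ModPolyOpsTheory.

(** * Substitution of an operator for the variable *)

Section ModPolySubst.
Variables (R : pzRingType) (U V W : lmodType R).

Lemma lin_mp_subst (phi : U -> W) (x : W -> W) :
  linear phi -> linear x -> linear (mp_subst phi x).
Proof.
move=> lphi lx.
apply: (@lin_sum_msupp R U W (fun n v => iter n x (phi v))) => n.
exact: lin_comp (lin_iter n lx) lphi.
Qed.

Lemma eq_mp_subst (phi psi : U -> W) (x : W -> W) p :
  phi =1 psi -> mp_subst phi x p = mp_subst psi x p.
Proof. by move=> e; apply: eq_bigr => n _; rewrite e. Qed.

Lemma mp_subst_lin_coef (phi f g : U -> W) (c : R) (x : W -> W) p :
  linear x -> (forall v, phi v = c *: f v + g v) ->
  mp_subst phi x p = c *: mp_subst f x p + mp_subst g x p.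
Proof.
move=> lx e; rewrite /mp_subst scaler_sumr -big_split /=.
by apply: eq_bigr => n _; rewrite e (lin_iter n lx).
Qed.

Lemma mp_subst_map (phi : V -> W) (f : U -> V) (x : W -> W) p :
  linear phi -> linear x -> f 0 = 0 ->
  mp_subst phi x (mp_map f p) = mp_subst (fun v => phi (f v)) x p.
Proof.
move=> lphi lx f0.
have l0 n : iter n x (phi 0) = 0.
  by rewrite (lin0 lphi) (lin0 (lin_iter n lx)).
rewrite /mp_subst (sum_msupp_widen (D := msupp p)
  (G := fun n v => iter n x (phi v))) ?msupp_mp_map //.
by apply: eq_bigr => n _; rewrite mp_map_coef.
Qed.

Lemma mp_subst_intertwine (g : V -> W) (phi : U -> V) (x : V -> V)
    (y : W -> W) p :
  linear g -> (forall q, g (x q) = y (g q)) ->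
  g (mp_subst phi x p) = mp_subst (fun v => g (phi v)) y p.
Proof.
move=> lg e; rewrite /mp_subst (lin_sum lg); apply: eq_bigr => n _.
(* The coefficient is generalized first, since its index is also the exponent on which the induction
   runs. *)
by move: p@_n => v; elim: n => [|n IHn] //=; rewrite e IHn.
Qed.

End ModPolySubst.

(** * Substitutions and extensions in two variables *)

Section TwoVariablesTheory.
Variables (R : pzRingType) (V : lmodType R).

Lemma lin_mp_skew (d : V -> V) : linear d -> linear (mp_skew d).
Proof.
move=> ld; apply: lin_mp_subst; first exact: lin_monom.
apply: lin_add; apply: lin_opp; [exact: lin_mp_mulX | exact: lin_mp_map].
Qed.

Lemma lin_mul_lambda : linear (@mul_lambda R V).
Proof. exact: lin_mp_map (@lin_mp_mulX R V). Qed.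

Lemma lin_mul_mu : linear (@mul_mu R V).
Proof. exact: lin_mp_mulX. Qed.

Lemma lin_bi_map (f : V -> V) : linear f -> linear (bi_map f).
Proof. by move=> lf; do 2!apply: lin_mp_map. Qed.

Lemma lin_bi_const :
  linear (fun v : V => << (<< v *g 0%N >> : modpoly V) *g 0%N >> : bipoly V).
Proof. exact: lin_comp (@lin_monom R (modpoly V) 0) (@lin_monom R V 0). Qed.

Lemma lin_bi_at (x : bipoly V -> bipoly V) : linear x -> linear (bi_at x).
Proof. exact: lin_mp_subst lin_bi_const. Qed.

Lemma lin_at_lambda : linear (@at_lambda R V).
Proof. exact: lin_bi_at lin_mul_lambda. Qed.

Lemma lin_at_mu : linear (@at_mu R V).
Proof. exact: lin_bi_at lin_mul_mu. Qed.

Lemma lin_at_lambda_plus_mu : linear (@at_lambda_plus_mu R V).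
Proof. exact: lin_bi_at (lin_add lin_mul_lambda lin_mul_mu). Qed.

Lemma lin_at_skew_mu (d : V -> V) : linear d -> linear (at_skew_mu d).
Proof.
move=> ld; apply: lin_bi_at.
apply: lin_add; apply: lin_opp; [exact: lin_mul_mu | exact: lin_bi_map].
Qed.

Lemma lin_bi_ext (phi : V -> bipoly V) : linear phi -> linear (bi_ext phi).
Proof.
move=> lphi; apply: lin_mp_subst lin_mul_mu; apply: lin_mp_subst lphi _.
exact: lin_mul_lambda.
Qed.

Lemma bi_ext_lin_coef (phi f g : V -> bipoly V) (c : R) q :
  (forall v, phi v = c *: f v + g v) ->
  bi_ext phi q = c *: bi_ext f q + bi_ext g q.
Proof.
move=> e; apply: mp_subst_lin_coef lin_mul_mu _ => p.
exact: mp_subst_lin_coef lin_mul_lambda e.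
Qed.

Lemma bi_ext_map (phi : V -> bipoly V) (f : V -> V) q :
  linear phi -> linear f ->
  bi_ext phi (bi_map f q) = bi_ext (fun v => phi (f v)) q.
Proof.
move=> lphi lf; rewrite /bi_ext /bi_map mp_subst_map; first 1 last.
- exact: lin_mp_subst lphi lin_mul_lambda.
- exact: lin_mul_mu.
- exact: lin0 (lin_mp_map lf).
apply: eq_mp_subst => p; apply: mp_subst_map (lin0 lf) => //.
exact: lin_mul_lambda.
Qed.

Lemma bi_map_mul_mu (f : V -> V) q : linear f ->
  bi_map f (mul_mu q) = mul_mu (bi_map f q).
Proof. by move=> lf; apply: mp_map_mulX; exact: lin_mp_map. Qed.

Lemma bi_map_mul_lambda (f : V -> V) q : linear f ->
  bi_map f (mul_lambda q) = mul_lambda (bi_map f q).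
Proof.
move=> lf; have lX := @lin_mp_mulX R V; have lm := lin_mp_map lf.
(* The variable of [mul_lambda] is the inner one, so comparing coefficients of the outer variable
   reduces the claim to one variable. *)
apply/malgP => n; rewrite !mp_map_coef ?(lin0 lX) ?(lin0 lm) //.
exact: mp_map_mulX.
Qed.

Lemma bi_map_comm (f g : V -> V) q : linear f -> linear g ->
  (forall v, f (g v) = g (f v)) ->
  bi_map f (bi_map g q) = bi_map g (bi_map f q).
Proof.
move=> lf lg e; have lmf := lin_mp_map lf; have lmg := lin_mp_map lg.
apply/malgP => n; rewrite !mp_map_coef ?(lin0 lmf) ?(lin0 lmg) //.
by apply/malgP => k; rewrite !mp_map_coef ?(lin0 lf) ?(lin0 lg).
Qed.

(** Commuting with [x], the map [f] slides through every iterate of [x] down to the constant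
    polynomials, where it acts on the coefficient itself. *)
Lemma bi_at_map (f : V -> V) (x : bipoly V -> bipoly V) p :
  linear f -> linear x -> (forall q, bi_map f (x q) = x (bi_map f q)) ->
  bi_at x (mp_map f p) = bi_map f (bi_at x p).
Proof.
move=> lf lx e; rewrite /bi_at (mp_subst_intertwine _ _ (lin_bi_map lf) e).
rewrite mp_subst_map ?(lin0 lf) //; last exact: lin_bi_const.
apply: eq_mp_subst => v.
by rewrite /bi_map !mp_map_monom ?(lin0 lf) ?(lin0 (lin_mp_map lf)).
Qed.

Lemma at_lambda_map (f : V -> V) p : linear f ->
  at_lambda (mp_map f p) = bi_map f (at_lambda p).
Proof.
move=> lf; apply: bi_at_map => // [|q]; first exact: lin_mul_lambda.
exact: bi_map_mul_lambda.
Qed.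

Lemma at_mu_map (f : V -> V) p : linear f ->
  at_mu (mp_map f p) = bi_map f (at_mu p).
Proof.
move=> lf; apply: bi_at_map => // [|q]; first exact: lin_mul_mu.
exact: bi_map_mul_mu.
Qed.

(** The substituted operator contains [d], whence the commutation of [f] with [d]. *)
Lemma at_skew_mu_map (f d : V -> V) p : linear f -> linear d ->
  (forall v, f (d v) = d (f v)) ->
  at_skew_mu d (mp_map f p) = bi_map f (at_skew_mu d p).
Proof.
move=> lf ld e; apply: bi_at_map => // [|q].
  by apply: lin_add; apply: lin_opp; [exact: lin_mul_mu | exact: lin_bi_map].
have lm := lin_bi_map lf.
by rewrite (linB lm) (linN lm) bi_map_mul_mu // (bi_map_comm _ lf ld e).
Qed.

End TwoVariablesTheory.

(* Stated over an abstract module because unification is slow on [bipoly]. *)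
Lemma rb_jacobi_rearrange (F : fieldType) (U : lmodType F) (w k : F)
    (l1 l2 l3 l4 l5 l6 l7 m1 m2 m3 m4 m5 m6 m7 : U) :
  l1 + (l2 + l3 + w *: l4) + w *: (l5 + l6 + w *: l7)
    - k *: (m2 + (m1 + m3 + w *: m6) + w *: (m5 + m4 + w *: m7))
  = ((l1 - k *: m1) + (l2 - k *: m2) + w *: (l5 - k *: m5))
    + (l3 - k *: m3)
    + w *: ((l6 - k *: m6) + (l4 - k *: m4) + w *: (l7 - k *: m7)).
Proof.
have comb (x y z x' y' z' : U) :
    (x - k *: x') + (y - k *: y') + w *: (z - k *: z')
    = (x + y + w *: z) - k *: (x' + y' + w *: z').
  rewrite scalerBr !scalerDr !opprD !scalerA [k * w]mulrC.
  by rewrite [in RHS]addrACA; congr (_ + _); exact: addrACA.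
rewrite !comb; congr (_ - k *: _); rewrite !scalerDr.
  by rewrite (AC (1*3*3) ((1*2*5)*3*(6*4*7))).
by rewrite (AC (1*3*3) ((2*1*5)*3*(4*6*7))).
Qed.

(** * The axioms for the Rota-Baxter bracket *)

Section RotaBaxter.
Variables (F : fieldType) (V : superspace F) (d : {linear V -> V}).
Variables (I : V -> V -> modpoly V) (w : F) (P : {linear V -> V}).
Hypotheses (hV : nonunital_vertex_algebra d I) (hP : rota_baxter d I w P).

Let Is := rb_bracket I w P.

Lemma rb_even : even_map P. Proof. by case: hP. Qed.
Lemma rb_comm a : P (d a) = d (P a). Proof. by case: hP. Qed.

(** This is the Rota-Baxter relation with its two mixed terms swapped. It gives the homomorphism
    property and also collapses [P] of an inner new bracket in the Jacobi identity. *)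
Lemma rb_hom a b : I (P a) (P b) = mp_map P (Is a b).
Proof. by case: hP => _ _ ->; rewrite /Is /rb_bracket [I (P a) b + _]addrC. Qed.

Lemma homogD e (a b : V) :
  a \in homog V e -> b \in homog V e -> a + b \in homog V e.
Proof.
by move=> ha hb; case: (homog_closed V e) => _ /(_ 1 a b ha hb); rewrite scale1r.
Qed.

Lemma homogZ e (c : F) (a : V) : a \in homog V e -> c *: a \in homog V e.
Proof.
case: (homog_closed V e) => h0 hl ha.
by have := hl c a 0 ha h0; rewrite addr0.
Qed.

Lemma rb_bracket_linl b : linear (Is^~ b).
Proof.
have lI := nva_linearl hV.
apply: lin_add; first apply: lin_add; [exact: lI | | exact/lin_scale/lI].
exact: lin_comp (lI b) (linearP P).
Qed.

Lemma rb_bracket_linr a : linear (Is a).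
Proof.
have lI := nva_linearr hV.
apply: lin_add; first apply: lin_add; [ | exact: lI | exact/lin_scale/lI].
exact: lin_comp (lI a) (linearP P).
Qed.

Lemma rb_bracket_even (e f : bool) (a b : V) :
  a \in homog V e -> b \in homog V f ->
  forall n : nat, (Is a b)@_n \in homog V (e (+) f).
Proof.
move=> ha hb n; have hI := nva_I_even hV; rewrite /Is /rb_bracket.
rewrite !mcoeffD mp_coefZ; do !apply: homogD; last apply: homogZ.
- by apply: hI => //; apply: rb_even.
- by apply: hI => //; apply: rb_even.
- exact: hI.
Qed.

Lemma rb_bracket_sesqui a b :
  mp_deriv (Is (d a) b) = - mp_mulX (mp_deriv (Is a b)).
Proof.
have lD := @lin_mp_deriv F V; have lX := @lin_mp_mulX F V.
(* Once [P (d a)] is [d (P a)], each of the three summands is an instance of the identity for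
   [I]. *)
rewrite /Is /rb_bracket rb_comm (lin_comb3 lD) !(nva_sesqui hV).
by rewrite -(lin_comb3 (lin_opp lX)) -(lin_comb3 lD).
Qed.

Lemma rb_bracket_derivation a b :
  mp_map d (Is a b) = Is (d a) b + Is a (d b).
Proof.
have lm := lin_mp_map (linearP d).
rewrite /Is /rb_bracket !rb_comm (lin_comb3 lm) !(nva_derivation hV).
by rewrite scalerDr [RHS]addrACA; congr (_ + _); exact: addrACA.
Qed.

(** [P] is even, so the three summands carry the same Koszul sign; swapping the arguments exchanges
    the two mixed terms. *)
Lemma rb_bracket_skewsym (e f : bool) (a b : V) :
  a \in homog V e -> b \in homog V f ->
  Is b a = koszul F e f *: mp_skew d (Is a b).
Proof.
move=> ha hb; have hPa := rb_even ha; have hPb := rb_even hb.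
have ls := lin_mp_skew (linearP d); rewrite /Is /rb_bracket.
rewrite (lin_comb3 ls) !scalerDr scalerA [_ * w]mulrC -scalerA.
rewrite -!(nva_skewsym hV) //.
by rewrite [I b (P a) + _]addrC.
Qed.

(** Expands the outer bracket of a nested one: the summand [I a (P v)] transfers [P] to the inner
    polynomial [q], where the Rota-Baxter relation can then act. *)
Lemma bi_ext_rb_bracketr (X : modpoly V -> bipoly V) a q : linear X ->
  bi_ext (fun v => X (Is a v)) q
  = bi_ext (fun v => X (I a v)) (bi_map P q)
    + bi_ext (fun v => X (I (P a) v)) q + w *: bi_ext (fun v => X (I a v)) q.
Proof.
move=> lX; have lI := lin_comp lX (nva_linearr hV a).
rewrite bi_ext_map //; last exact: linearP.
rewrite (bi_ext_lin_coef (c := w) (f := fun v => X (I a v))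
  (g := fun v => X (I a (P v)) + X (I (P a) v))); last first.
  by move=> v; rewrite /Is /rb_bracket (lin_comb3 lX) addrC.
rewrite addrC (bi_ext_lin_coef (c := 1) (f := fun v => X (I a (P v)))
  (g := fun v => X (I (P a) v))) ?scale1r // => v.
by rewrite scale1r.
Qed.

Lemma bi_ext_rb_bracketl (X : modpoly V -> bipoly V) c q : linear X ->
  bi_ext (fun v => X (Is v c)) q
  = bi_ext (fun v => X (I v (P c))) q
    + bi_ext (fun v => X (I v c)) (bi_map P q)
    + w *: bi_ext (fun v => X (I v c)) q.
Proof.
move=> lX; have lI := lin_comp lX (nva_linearl hV c).
rewrite bi_ext_map //; last exact: linearP.
rewrite (bi_ext_lin_coef (c := w) (f := fun v => X (I v c))
  (g := fun v => X (I v (P c)) + X (I (P v) c))); last first.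
  by move=> v; rewrite /Is /rb_bracket (lin_comb3 lX) addrC.
rewrite addrC (bi_ext_lin_coef (c := 1) (f := fun v => X (I v (P c)))
  (g := fun v => X (I (P v) c))) ?scale1r // => v.
by rewrite scale1r.
Qed.

Lemma bi_map_rb_skew a b :
  bi_map P (at_lambda (Is a b) - at_skew_mu d (Is a b))
  = at_lambda (I (P a) (P b)) - at_skew_mu d (I (P a) (P b)).
Proof.
have [lP ld] := (linearP P, linearP d).
rewrite (linB (lin_bi_map lP)) -at_lambda_map // -at_skew_mu_map ?rb_hom //.
exact: rb_comm.
Qed.

Lemma rb_bracket_jacobi (e f : bool) (a b c : V) :
  a \in homog V e -> b \in homog V f ->
  bi_ext (fun v => at_lambda (Is a v)) (at_mu (Is b c))
    - koszul F e f *: bi_ext (fun v => at_mu (Is b v)) (at_lambda (Is a c))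
  = bi_ext (fun v => at_lambda_plus_mu (Is v c))
           (at_lambda (Is a b) - at_skew_mu d (Is a b)).
Proof.
move=> ha hb; have hPa := rb_even ha; have hPb := rb_even hb.
have [lP ld] := (linearP P, linearP d).
have [lL lM] := (@lin_at_lambda F V, @lin_at_mu F V).
have lLM := @lin_at_lambda_plus_mu F V; have lS := lin_at_skew_mu ld.
have [lIl lIr] := (nva_linearl hV, nva_linearr hV).
(* [L], [M] and [N] are the three terms of the Jacobi identity for [I] at [x], [y], [z]. *)
pose L x y z := bi_ext (fun v => at_lambda (I x v)) (at_mu (I y z)).
pose M x y z := bi_ext (fun v => at_mu (I y v)) (at_lambda (I x z)).
pose N x y z := bi_ext (fun v => at_lambda_plus_mu (I v z))
  (at_lambda (I x y) - at_skew_mu d (I x y)).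
have -> : bi_ext (fun v => at_lambda (Is a v)) (at_mu (Is b c))
    = L a (P b) (P c) + (L (P a) b (P c) + L (P a) (P b) c + w *: L (P a) b c)
      + w *: (L a b (P c) + L a (P b) c + w *: L a b c).
  (* The summand with [P] on the inner bracket collapses to a single term by [rb_hom]; the other two
     split in three each, which gives seven. *)
  rewrite (bi_ext_rb_bracketr a _ lL) -(at_mu_map _ lP) -rb_hom.
  have E x := lin_comb3 (lin_comp (lin_bi_ext (lin_comp lL (lIr x))) lM).
  congr (_ + _ + w *: _); exact: E.
have -> : bi_ext (fun v => at_mu (Is b v)) (at_lambda (Is a c))
    = M (P a) b (P c) + (M a (P b) (P c) + M (P a) (P b) c + w *: M a (P b) c)
      + w *: (M a b (P c) + M (P a) b c + w *: M a b c).
  rewrite (bi_ext_rb_bracketr b _ lM) -(at_lambda_map _ lP) -rb_hom.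
  have E x := lin_comb3 (lin_comp (lin_bi_ext (lin_comp lM (lIr x))) lL).
  congr (_ + _ + w *: _); exact: E.
have -> : bi_ext (fun v => at_lambda_plus_mu (Is v c))
      (at_lambda (Is a b) - at_skew_mu d (Is a b))
    = (N a (P b) (P c) + N (P a) b (P c) + w *: N a b (P c)) + N (P a) (P b) c
      + w *: (N a (P b) c + N (P a) b c + w *: N a b c).
  rewrite (bi_ext_rb_bracketl c _ lLM) bi_map_rb_skew.
  have E x := lin_comb3 (lin_comp (lin_bi_ext (lin_comp lLM (lIl x)))
    (lin_add lL (lin_opp lS))).
  congr (_ + _ + w *: _); exact: E.
have jac x y z : x \in homog V e -> y \in homog V f ->
    N x y z = L x y z - koszul F e f *: M x y z.
  by move=> hx hy; exact: esym (nva_jacobi hV z hx hy).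
(* Every instance has first two arguments of parities [e] and [f], hence one common sign. With [L],
   [M], [N] opaque, a plain module identity remains. *)
rewrite !jac //; clearbody L M N.
exact: rb_jacobi_rearrange.
Qed.

End RotaBaxter.

Theorem theorem2p6 (F : fieldType) (charF0 : [pchar F] =i pred0)
    (V : superspace F) (d : {linear V -> V}) (I : V -> V -> modpoly V)
    (hV : nonunital_vertex_algebra d I)
    (w : F) (P : {linear V -> V}) (hP : rota_baxter d I w P) :
  nonunital_vertex_algebra d (rb_bracket I w P)
  /\ nva_hom d (rb_bracket I w P) d I P.
Proof.
split; split.
- exact: nva_d_even hV.
- exact: rb_bracket_linl hV.
- exact: rb_bracket_linr hV.
- exact: rb_bracket_even hV hP.
- exact: rb_bracket_sesqui hV hP.
- exact: rb_bracket_derivation hV hP.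
- exact: rb_bracket_skewsym hV hP.
- exact: rb_bracket_jacobi hV hP.
- exact: rb_even hP.
- exact: rb_comm hP.
- exact: rb_hom hP.
Qed.
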